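(* Let $p,q$ be two relatively prime, positive integers. Then for any integer $n$ the equality $$d(L(p,q),n) = 2\,s(q,p;n)+s(q,p)-\frac{1}{2p}$$ holds.
   Context: Heegaard Floer correction terms. For a rational homology $3$-sphere $Y$ with a spin$^{\mathbb C}$-structure $\mathfrak s$, $d(Y,\mathfrak s)\in\mathbb Q$ denotes the Heegaard Floer correction term of Ozsváth and Szabó. For the lens space $L(p,q)$ (oriented so that it is $p/q$-surgery on the unknot in $S^3$), the set of spin$^{\mathbb C}$-structures is identified with $H^2(L(p,q);\mathbb Z)\cong\mathbb Z/p\mathbb Z$ by the Ozsváth–Szabó labelling, and one writes $d(L(p,q),n)$ for $n\in\mathbb Z/p\mathbb Z$ (or for an integer $n$, taken modulo $p$). For $p>0$ these numbers depend on $q$ and $n$ only modulo $p$ (since $L(p,q+kp)\cong L(p,q)$ for $k\in\mathbb Z$), satisfy $d(L(1,1),0)=0$, and by a theorem of Ozsváth and Szabó satisfy, for all relatively prime $0<q<p$ and $0\le n<p+q$, the reciprocity formula $$d(L(p,q),n)+d(L(q,p),n)=\frac14+\frac{n^2}{pq}+n\left(\frac1{pq}-\frac1q-\frac1p\right)+\frac14\left(\frac pq+\frac1{pq}+\frac qp\right)-\frac1{2q}-\frac1{2p}.$$ These properties determine all $d(L(p,q),n)$ for relatively prime $p,q>0$. Dedekind–Rademacher sum. Let $\bar B_1(x)=\{x\}-\frac12$ with $\{x\}=x-\lfloor x\rfloor$ (so $\bar B_1(x)=-\frac12$ for $x\in\mathbb Z$). For relatively prime nonzero integers $p,q$ and any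 integer $n$, $$s(q,p;n)=\sum_{k=0}^{|p|-1}\bar B_1\left(\frac{kq+n}{p}\right)\bar B_1\left(\frac kp\right).$$ Dedekind sum. Let $((x))=x-\lfloor x\rfloor-\frac12$ if $x\notin\mathbb Z$ and $((x))=0$ if $x\in\mathbb Z$. For relatively prime $q,p$ with $p>0$, $$s(q,p)=\sum_{k=0}^{p-1}\left(\left(\frac{kq}{p}\right)\right)\left(\left(\frac kp\right)\right).$$ *)

(* Defs.v *)
From mathcomp Require Import all_boot all_order all_algebra.

Set Implicit Arguments.
Unset Strict Implicit.
Unset Printing Implicit Defensive.

Import Order.TTheory GRing.Theory Num.Theory.

Local Open Scope ring_scope.

(* Heegaard Floer homology is not available in the libraries.  The correction
   terms of lens spaces therefore enter through the properties that determine
   them: [d p q n] stands for d(L(p,q),n), where L(p,q) is p/q-surgery on the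
   unknot and the integer n is the Ozsvath-Szabo label of the spin^c structure,
   taken modulo p.  Nothing is required of [d p q n] unless p > 0 and p, q are
   coprime. *)
Record lens_correction_terms (d : int -> int -> int -> rat) : Prop := {
  lens_d_periodic_q (p q k n : int) :
    0 < p -> coprimez p q -> d p (q + k * p) n = d p q n;
  lens_d_periodic_n (p q k n : int) :
    0 < p -> coprimez p q -> d p q (n + k * p) = d p q n;
  lens_d_sphere : d 1 1 0 = 0;
  lens_d_reciprocity (p q n : int) :
    coprimez p q -> 0 < q < p -> 0 <= n < p + q ->
    d p q n + d q p n =
      1 / 4 + n%:Q ^+ 2 / (p%:Q * q%:Q)
      + n%:Q * (1 / (p%:Q * q%:Q) - 1 / q%:Q - 1 / p%:Q)
      + 1 / 4 * (p%:Q / q%:Q + 1 / (p%:Q * q%:Q) + q%:Q / p%:Q)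
      - 1 / (2 * q%:Q) - 1 / (2 * p%:Q)
}.

(* Periodic first Bernoulli function; the value at integers is -1/2, whereas
   [sawtooth] vanishes there. *)
Definition bernoulli1 (x : rat) : rat := x - (Num.floor x)%:~R - 1 / 2.

Definition sawtooth (x : rat) : rat :=
  if x \is a Num.int then 0 else x - (Num.floor x)%:~R - 1 / 2.

(* s(q,p;n) *)
Definition dedekind_rademacher (q p n : int) : rat :=
  \sum_(k < `|p|%N)
    bernoulli1 ((k%:Z * q + n)%:Q / p%:Q) * bernoulli1 (k%:Q / p%:Q).

(* s(q,p), meant for p > 0 *)
Definition dedekind (q p : int) : rat :=
  \sum_(k < `|p|%N) sawtooth ((k%:Z * q)%:Q / p%:Q) * sawtooth (k%:Q / p%:Q).

(* Main.v *)
(* Induction on [p] along the Euclidean algorithm reduces everything to showing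
   that the right-hand side satisfies the same reciprocity formula.  Up to
   elementary terms, s(q,p;n) is the sum of k ((k q + n) mod p) over k < p.
   Passing from n to n + 1 raises every residue by one, except at the k where
   p divides k q + n + 1; this k and its analogue l for s(p,q;n) satisfy
   k q + l p + n + 1 = p q as long as n + 1 < p + q.  Hence the reciprocity
   formula at n follows from the one at n = 0, which is Dedekind's: compare the
   squares of k q mod p with those of k, and count lattice points on both sides
   of the diagonal of the p by q rectangle. *)
Require Import Defs.
From mathcomp Require Import all_boot all_order all_algebra.
From mathcomp Require Import zify ring lra.

Set Implicit Arguments.
Unset Strict Implicit.
Unset Printing Implicit Defensive.

Import Order.TTheory GRing.Theory Num.Theory.

Local Open Scope ring_scope.

Lemma floor_divn (m p : nat) : (0 < p)%N ->
  Num.floor (m%:R / p%:R : rat) = (m %/ p)%N.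
Proof.
move=> p0; have p0' : 0 < p%:R :> rat by rewrite ltr0n.
apply: floor_def; rewrite -PoszD -!pmulrn ler_pdivlMr // ltr_pdivrMr //.
by rewrite -!natrM ler_nat ltr_nat leq_divM addn1 ltn_ceil.
Qed.

Lemma divn_modnE (m p : nat) :
  (m %% p)%:R = m%:R - (m %/ p)%:R * p%:R :> rat.
Proof. by rewrite {2}(divn_eq m p) natrD natrM addrC addKr. Qed.

Lemma bernoulli1_divn (m p : nat) : (0 < p)%N ->
  bernoulli1 (m%:R / p%:R) = (m %% p)%:R / p%:R - 1 / 2.
Proof.
move=> p0; have p0' : p%:R != 0 :> rat by rewrite pnatr_eq0 -lt0n.
by rewrite /bernoulli1 floor_divn // -pmulrn divn_modnE; field.
Qed.

Lemma sawtooth_divn (m p : nat) : (0 < p)%N ->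
  sawtooth (m%:R / p%:R)
  = if (p %| m)%N then 0 else bernoulli1 (m%:R / p%:R).
Proof.
move=> p0; have p0' : p%:R != 0 :> rat by rewrite pnatr_eq0 -lt0n.
rewrite /sawtooth -/(bernoulli1 _) intrEfloor floor_divn // -pmulrn.
suff -> : ((m %/ p)%:R == m%:R / p%:R :> rat) = (p %| m)%N by [].
by rewrite -(inj_eq (mulIf p0')) divfK // -natrM eqr_nat dvdn_eq.
Qed.

Lemma modn_affine_inj (p q n k l : nat) : coprime p q ->
  (k < p)%N -> (l < p)%N -> (k * q + n = l * q + n %[mod p])%N -> k = l.
Proof.
move=> cpq; wlog lekl : k l / (k <= l)%N => [th kp lp e|].
  by case/orP: (leq_total k l) => ?; [|symmetry]; apply: th.
move=> kp lp /eqP; rewrite eqn_modDr eq_sym eqn_mod_dvd ?leq_mul2r ?lekl ?orbT //.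
rewrite -mulnBl Gauss_dvdl // => /dvdn_leq; lia.
Qed.

Section Affine.
Variables (p q n : nat).
Hypotheses (p0 : (0 < p)%N) (cpq : coprime p q).

Definition affine_ord (k : 'I_p) : 'I_p := Ordinal (ltn_pmod (k * q + n) p0).

Lemma affine_ord_inj : injective affine_ord.
Proof. by move=> k l [e]; apply/val_inj/(modn_affine_inj cpq _ _ e). Qed.

Lemma sum_modn_affine (F : nat -> rat) :
  \sum_(k < p) F ((k * q + n) %% p)%N = \sum_(k < p) F k.
Proof. by rewrite [RHS](reindex_inj affine_ord_inj). Qed.

Lemma dvdn_affine_ex : exists2 k, (k < p)%N & (p %| k * q + n)%N.
Proof.
have /codomP[k e] := injF_onto affine_ord_inj (Ordinal p0).
by exists k => //; rewrite /dvdn -[X in X == _](congr1 val e).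
Qed.

End Affine.

Lemma sum_ord_id (p : nat) :
  \sum_(k < p) k%:R = p%:R * (p%:R - 1) / 2 :> rat.
Proof.
elim: p => [|p IH]; first by rewrite big_ord0; lra.
by rewrite big_ord_recr /= IH -natr1; field.
Qed.

Lemma sum_ord_sqr (p : nat) :
  \sum_(k < p) k%:R ^+ 2 = p%:R * (p%:R - 1) * (2 * p%:R - 1) / 6 :> rat.
Proof.
elim: p => [|p IH]; first by rewrite big_ord0; lra.
by rewrite big_ord_recr /= IH -natr1; field.
Qed.

Definition modsum (p q n : nat) : rat :=
  \sum_(k < p) k%:R * ((k * q + n) %% p)%:R.

Lemma dedekind_rademacherE (p q n : nat) : (0 < p)%N -> coprime p q ->
  dedekind_rademacher q p n = modsum p q n / p%:R ^+ 2 + 1 / 2 - p%:R / 4.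
Proof.
move=> p0 cpq; have p0' : p%:R != 0 :> rat by rewrite pnatr_eq0 -lt0n.
rewrite /dedekind_rademacher absz_nat.
have e (k : 'I_p) : bernoulli1 ((k%:Z * q + n)%:Q / p%:Q)
    * bernoulli1 (k%:Q / p%:Q)
  = k%:R * ((k * q + n) %% p)%:R / p%:R ^+ 2
    - ((k * q + n) %% p)%:R / (2 * p%:R) - k%:R / (2 * p%:R) + 1 / 4.
  rewrite -PoszM -PoszD -!pmulrn !bernoulli1_divn // (modn_small (ltn_ord k)).
  by field.
rewrite (eq_bigr _ (fun k _ => e k)) !(sumrB, big_split) /= -!mulr_suml.
rewrite (sum_modn_affine n p0 cpq (fun m => m%:R)) sum_ord_id -/(modsum p q n).
by rewrite sumr_const card_ord -mulr_natr; field.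
Qed.

Lemma dedekindE (p q : nat) : (0 < p)%N -> coprime p q ->
  dedekind q p = dedekind_rademacher q p 0 - 1 / 4.
Proof.
case: p => // p _ cpq; rewrite /dedekind /dedekind_rademacher absz_nat.
rewrite !big_ord_recl /= !mul0r ?add0r.
have -> : bernoulli1 0 = - (1 / 2) by rewrite /bernoulli1 floor0; lra.
rewrite addrAC (_ : _ - 1 / 4 = 0) ?add0r; last by lra.
apply: eq_bigr => k _; rewrite addr0 -PoszM -!pmulrn !sawtooth_divn //.
by rewrite Gauss_dvdl // gtnNdvd //= /bump /= ltnS.
Qed.

Lemma modsumS (p q n : nat) : (0 < p)%N -> coprime p q ->
  exists k, [/\ (k < p)%N, (p %| k * q + n.+1)%N &
    modsum p q n.+1 = modsum p q n + p%:R * (p%:R - 1) / 2 - p%:R * k%:R].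
Proof.
move=> p0 cpq; have [k kp dk] := dvdn_affine_ex n.+1 p0 cpq.
exists k; split => //; rewrite -sum_ord_id /modsum -big_split /=.
rewrite [LHS](bigD1 (Ordinal kp)) //= [in RHS](bigD1 (Ordinal kp)) //=.
have e : (((k * q + n) %% p).+1 = p)%N.
  apply/eqP; rewrite eqn_leq ltn_pmod // dvdn_leq //.
  rewrite -(dvdn_addr _ (dvdn_mull ((k * q + n) %/ p) (dvdnn p))).
  by rewrite addnS -divn_eq -addnS.
rewrite (eqP dk) mulr0 add0r.
have -> : p%:R = ((k * q + n) %% p)%:R + 1 :> rat by rewrite natr1 e.
rewrite [RHS]addrAC -[LHS]add0r; congr (_ + _); first by ring.
apply: eq_bigr => i ik; rewrite addnS modnS ifF -?natr1; first by ring.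
apply/negP; rewrite -addnS => di.
case/eqP: ik; apply/val_inj/(modn_affine_inj (n := n.+1) cpq _ _) => //=.
by rewrite (eqP di) (eqP dk).
Qed.

Lemma sum_ord_lt (F : nat -> rat) (m p : nat) : (m <= p)%N ->
  \sum_(k < p) F k * (k < m)%:R = \sum_(k < m) F k.
Proof.
move=> mp; rewrite [RHS](big_ord_widen p F mp) [RHS]big_mkcond /=.
by apply: eq_bigr => k _; case: ifP; rewrite ?mulr1 ?mulr0.
Qed.

Lemma sum_ord_lt1 (m p : nat) : (m <= p)%N ->
  \sum_(k < p) (k < m)%:R = m%:R :> rat.
Proof.
move=> /(sum_ord_lt (fun=> 1)); under eq_bigr do rewrite mul1r.
by rewrite sumr_const card_ord.
Qed.

Section LatticeCount.
Variables (p q : nat).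
Hypotheses (p0 : (0 < p)%N) (q0 : (0 < q)%N) (cpq : coprime p q).

(* Off the origin the diagonal of the [p * q] rectangle avoids lattice points. *)
Lemma leq_diagonal (j k : nat) : (j < q)%N ->
  (j <= k * q %/ p)%:R
  = 1 - (k < (j * p %/ q).+1)%:R + ((j < 1) && (k < 1))%N%:R :> rat.
Proof.
move=> jq; rewrite leq_divRL // ltnS leq_divRL // !ltnS !leqn0.
case: (ltngtP (j * p) (k * q)) => [lt|gt|e].
- suff -> : (j == 0)%N && (k == 0)%N = false by [].
  by apply: contraTF lt => /andP[/eqP-> /eqP->].
- suff -> : (j == 0)%N && (k == 0)%N = false by [].
  by apply: contraTF gt => /andP[/eqP-> /eqP->].
- have: (q %| j * p)%N by rewrite e dvdn_mull.
  rewrite Gauss_dvdl 1?coprime_sym // => dj.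
  have j0 : j = 0.
    apply/eqP; apply: contraTT jq => j0.
    by rewrite -leqNgt dvdn_leq // lt0n.
  have -> : k = 0 by move: e; rewrite j0; nia.
  by rewrite j0.
Qed.

Lemma sum_divn :
  \sum_(k < p) (k * q %/ p)%:R = (p%:R - 1) * (q%:R - 1) / 2 :> rat.
Proof.
have p0' : p%:R != 0 :> rat by rewrite pnatr_eq0 -lt0n.
have := sum_modn_affine 0 p0 cpq (fun m => m%:R).
under eq_bigr do rewrite addn0 divn_modnE natrM.
rewrite sumrB -!mulr_suml sum_ord_id => e.
by apply: (mulIf p0'); lra.
Qed.

Lemma sum_divn_sqr :
  \sum_(k < p) (k * q %/ p)%:R ^+ 2
  = (p%:R - 1) * (q%:R - 1) ^+ 2 + \sum_(j < q) (j * p %/ q)%:R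
    - 2 * \sum_(j < q) j%:R * (j * p %/ q)%:R :> rat.
Proof.
have sum_odd m : \sum_(j < m) (2 * j%:R - 1) = m%:R ^+ 2 - 2 * m%:R :> rat.
  by rewrite sumrB -mulr_sumr sum_ord_id sumr_const card_ord; field.
have sqrE (k : 'I_p) : (k * q %/ p)%:R ^+ 2
    = 1 + \sum_(j < q) (2 * j%:R - 1) * (j <= k * q %/ p)%:R :> rat.
  rewrite (sum_ord_lt (fun j => 2 * j%:R - 1) (m := (k * q %/ p).+1)).
    by rewrite sum_odd -natr1; ring.
  by rewrite ltn_divLR // mulnC ltn_pmul2l.
rewrite (eq_bigr _ (fun k _ => sqrE k)) big_split /= sumr_const card_ord.
rewrite exchange_big /=.
have inner (j : 'I_q) : \sum_(k < p) (2 * j%:R - 1) * (j <= k * q %/ p)%:R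
    = (p%:R - 1) * (2 * j%:R - 1) + (j * p %/ q)%:R
      - 2 * (j%:R * (j * p %/ q)%:R) + (2 * j%:R - 1) * (j < 1)%:R :> rat.
  have origin : \sum_(k < p) ((j < 1) && (k < 1))%N%:R = (j < 1)%:R :> rat.
    under eq_bigr do rewrite -mulnb natrM.
    by rewrite -mulr_sumr sum_ord_lt1 // mulr1.
  rewrite -mulr_sumr; under eq_bigr do rewrite leq_diagonal //.
  rewrite big_split sumrB /= origin sumr_const card_ord sum_ord_lt1.
    by rewrite -natr1; ring.
  by rewrite ltn_divLR // mulnC ltn_pmul2l.
rewrite (eq_bigr _ (fun j _ => inner j)) !(big_split, sumrB) /= -!mulr_sumr.
rewrite (sum_ord_lt (fun j => 2 * j%:R - 1)) // big_ord1 /=.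
rewrite sumrN sumrB -mulr_sumr sum_ord_id sumr_const card_ord -mulr_sumr.
set A := \sum_(j < q) _; set B := \sum_(j < q) _.
by field.
Qed.

Lemma modsum0E :
  modsum p q 0 = q%:R * \sum_(k < p) k%:R ^+ 2
    - p%:R * \sum_(k < p) k%:R * (k * q %/ p)%:R.
Proof.
rewrite !mulr_sumr -sumrB; apply: eq_bigr => k _.
by rewrite addn0 divn_modnE natrM; ring.
Qed.

Lemma sum_modn_sqr :
  (q%:R ^+ 2 - 1) * \sum_(k < p) k%:R ^+ 2
  = 2 * p%:R * q%:R * \sum_(k < p) k%:R * (k * q %/ p)%:R
    - p%:R ^+ 2 * \sum_(k < p) (k * q %/ p)%:R ^+ 2 :> rat.
Proof.
rewrite mulrBl mul1r -{2}(sum_modn_affine 0 p0 cpq (fun m => m%:R ^+ 2)).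
rewrite !mulr_sumr -!sumrB; apply: eq_bigr => k _.
by rewrite addn0 divn_modnE natrM; ring.
Qed.

End LatticeCount.

Lemma modsum_reciprocity0 (p q : nat) :
  (0 < p)%N -> (0 < q)%N -> coprime p q ->
  modsum p q 0 / p%:R ^+ 2 + modsum q p 0 / q%:R ^+ 2
  = (p%:R + q%:R) / 4 - 3 / 4
    + (p%:R / q%:R + q%:R / p%:R + 1 / (p%:R * q%:R)) / 12.
Proof.
move=> p0 q0 cpq.
have p0' : p%:R != 0 :> rat by rewrite pnatr_eq0 -lt0n.
have q0' : q%:R != 0 :> rat by rewrite pnatr_eq0 -lt0n.
have := sum_modn_sqr p0 cpq; rewrite sum_divn_sqr // sum_divn 1?coprime_sym //.
rewrite !modsum0E !sum_ord_sqr.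
set A := \sum_(k < p) _; set B := \sum_(j < q) _.
move: A B p0' q0'; move: (p%:R : rat) (q%:R : rat) => x y A B x0 y0 e.
have -> : A = ((y ^+ 2 - 1) * (x * (x - 1) * (2 * x - 1) / 6)
    + x ^+ 2 * ((x - 1) * (y - 1) ^+ 2 + (y - 1) * (x - 1) / 2 - 2 * B))
    / (2 * x * y) by rewrite e; field; rewrite x0 y0.
by field; rewrite x0 y0.
Qed.

Lemma modsum_reciprocity (p q n : nat) :
  (0 < p)%N -> (0 < q)%N -> coprime p q -> (n < p + q)%N ->
  modsum p q n / p%:R ^+ 2 + modsum q p n / q%:R ^+ 2
  = (p%:R + q%:R) / 4 - 3 / 4
    + (p%:R / q%:R + q%:R / p%:R + 1 / (p%:R * q%:R)) / 12
    + n%:R * (n%:R + 1) / (2 * p%:R * q%:R) - n%:R * (1 / p%:R + 1 / q%:R) / 2.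
Proof.
move=> p0 q0 cpq.
have p0' : p%:R != 0 :> rat by rewrite pnatr_eq0 -lt0n.
have q0' : q%:R != 0 :> rat by rewrite pnatr_eq0 -lt0n.
elim: n => [_|n IH ltn]; first by rewrite modsum_reciprocity0 //; ring.
have [k [kp dk ->]] := modsumS n p0 cpq.
have cqp : coprime q p by rewrite coprime_sym.
have [l [lq dl ->]] := modsumS n q0 cqp.
(* [k q + l p + n + 1] is a multiple of [p q] lying strictly between [0] and
   [2 p q]. *)
have e : (k * q + l * p + n.+1 = p * q)%N.
  have /dvdnP[c] : (p * q %| k * q + l * p + n.+1)%N.
    rewrite Gauss_dvd // addnAC dvdn_addl ?dvdn_mull // dk /=.
    by rewrite addnAC -addnA dvdn_addr ?dvdn_mull // addnC.
  have kq : (k * q + q <= p * q)%N by rewrite addnC -mulSn leq_mul2r kp orbT.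
  have lp : (l * p + p <= p * q)%N.
    by rewrite addnC -mulSn mulnC leq_mul2l lq orbT.
  by case: c => [|[|c]]; rewrite ?mulSn; lia.
have {}e : k%:R = (p%:R * q%:R - n.+1%:R - l%:R * p%:R) / q%:R :> rat.
  by rewrite -natrM -e !natrD !natrM; field.
move/(_ (ltnW ltn)): IH => IH.
have -> : modsum p q n = p%:R ^+ 2 * ((p%:R + q%:R) / 4 - 3 / 4
    + (p%:R / q%:R + q%:R / p%:R + 1 / (p%:R * q%:R)) / 12
    + n%:R * (n%:R + 1) / (2 * p%:R * q%:R) - n%:R * (1 / p%:R + 1 / q%:R) / 2
    - modsum q p n / q%:R ^+ 2) by rewrite -IH; field; rewrite p0' q0'.
by rewrite e -natr1; field; rewrite p0' q0'.
Qed.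

Lemma bernoulli1_addz (x : rat) (m : int) :
  bernoulli1 (x + m%:~R) = bernoulli1 x.
Proof. by rewrite /bernoulli1 floorDrz ?intr_int // intrKfloor intrD; ring. Qed.

Lemma sawtooth_addz (x : rat) (m : int) : sawtooth (x + m%:~R) = sawtooth x.
Proof.
rewrite /sawtooth -!/(bernoulli1 _) bernoulli1_addz.
by rewrite rpredDr ?intr_int.
Qed.

Definition lens_value (p q n : int) : rat :=
  2 * dedekind_rademacher q p n + dedekind q p - 1 / (2 * p%:Q).

Lemma lens_value_periodic (p q n a b : int) : p != 0 ->
  lens_value p (q + a * p) (n + b * p) = lens_value p q n.
Proof.
move=> p0; have p0' : p%:Q != 0 by rewrite intr_eq0.
rewrite /lens_value; congr (2 * _ + _ - _); apply: eq_bigr => k _;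
  congr (_ * _).
- rewrite -[RHS](bernoulli1_addz _ (k%:Z * a + b)); congr bernoulli1.
  by rewrite !(intrD, intrM); field.
- rewrite -[RHS](sawtooth_addz _ (k%:Z * a)); congr sawtooth.
  by rewrite !(intrD, intrM); field.
Qed.

Lemma lens_valueE (p q n : nat) : (0 < p)%N -> coprime p q ->
  lens_value p q n = (2 * modsum p q n + modsum p q 0) / p%:R ^+ 2
    + 5 / 4 - 3 * p%:R / 4 - 1 / (2 * p%:R).
Proof.
move=> p0 cpq; have p0' : p%:R != 0 :> rat by rewrite pnatr_eq0 -lt0n.
by rewrite /lens_value dedekindE // !dedekind_rademacherE // -pmulrn; field.
Qed.

Lemma lens_value1 (q n : nat) : lens_value 1 q n = 0.
Proof.
rewrite lens_valueE ?coprime1n // /modsum !big_ord1 !mul0r.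
by field.
Qed.

Lemma lens_value_reciprocity (p q n : nat) :
  (0 < p)%N -> (0 < q)%N -> coprime p q -> (n < p + q)%N ->
  lens_value p q n + lens_value q p n =
    1 / 4 + n%:Q ^+ 2 / (p%:Q * q%:Q)
    + n%:Q * (1 / (p%:Q * q%:Q) - 1 / q%:Q - 1 / p%:Q)
    + 1 / 4 * (p%:Q / q%:Q + 1 / (p%:Q * q%:Q) + q%:Q / p%:Q)
    - 1 / (2 * q%:Q) - 1 / (2 * p%:Q).
Proof.
move=> p0 q0 cpq ltn.
have p0' : p%:R != 0 :> rat by rewrite pnatr_eq0 -lt0n.
have q0' : q%:R != 0 :> rat by rewrite pnatr_eq0 -lt0n.
rewrite !lens_valueE // 1?coprime_sym // -!pmulrn.
have := modsum_reciprocity p0 q0 cpq ltn.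
have := modsum_reciprocity0 p0 q0 cpq.
set A := modsum p q n; set B := modsum q p n.
set A0 := modsum p q 0; set B0 := modsum q p 0 => e0 e.
transitivity (2 * (A / p%:R ^+ 2 + B / q%:R ^+ 2)
    + (A0 / p%:R ^+ 2 + B0 / q%:R ^+ 2)
    + 5 / 2 - 3 * (p%:R + q%:R) / 4 - 1 / (2 * p%:R) - 1 / (2 * q%:R)).
  by field; rewrite p0' q0'.
by rewrite e e0; field; rewrite p0' q0'.
Qed.

Lemma lens_dE (d : int -> int -> int -> rat) (p : nat) :
  lens_correction_terms d -> (0 < p)%N ->
  forall q n : int, coprimez p q -> d p q n = lens_value p q n.
Proof.
move=> hd; elim/ltn_ind: p => p IH p0 q n cpq.
have pn0 : (p : int) != 0 by rewrite -lt0n.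
have hp : 0 < p :> int by rewrite ltz_nat.
have cpq' : coprimez p (q %% p)%Z by rewrite /coprimez gcdz_modr.
have -> : d p q n = d p (q %% p)%Z (n %% p)%Z.
  rewrite -(lens_d_periodic_q hd (q %/ p)%Z _ hp cpq') addrC -divz_eq.
  rewrite -(lens_d_periodic_n hd (n %/ p)%Z (n %% p)%Z hp cpq).
  by rewrite addrC -divz_eq.
have -> : lens_value p q n = lens_value p (q %% p)%Z (n %% p)%Z.
  rewrite -[RHS](lens_value_periodic _ _ (q %/ p)%Z (n %/ p)%Z pn0).
  by congr lens_value; rewrite addrC -divz_eq.
have := ltz_pmod q hp; have := ltz_pmod n hp.
have := modz_ge0 q pn0; have := modz_ge0 n pn0; move: cpq'.
case: (q %% p)%Z => // a; case: (n %% p)%Z => // b cpa _ _.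
rewrite !ltz_nat => bp ap.
have [p1 | p1] := eqVneq p 1%N.
  rewrite p1 lens_value1; move: ap bp; rewrite p1.
  case: a {cpa} => // _; case: b => // _.
  by rewrite -(lens_d_periodic_q hd 1) // add0r mul1r (lens_d_sphere hd).
have a0 : (0 < a)%N.
  by case: a cpa {ap} => //; rewrite coprimezE /= /coprime gcdn0 (negPf p1).
have cap : coprimez a p by rewrite coprimezE coprime_sym -coprimezE.
have ltb : (b < p + a)%N by rewrite ltn_addr.
apply: (addIr (d a p b)); rewrite {2}(IH a) //.
rewrite lens_value_reciprocity -?coprimezE // (lens_d_reciprocity hd) //.
by rewrite !ltz_nat a0 ap.
Qed.

Theorem theorem1p2 (d : int -> int -> int -> rat)
    (hd : lens_correction_terms d)
    (p q : int) (hp : 0 < p) (hq : 0 < q) (hpq : coprimez p q) (n : int) :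
  d p q n = 2 * dedekind_rademacher q p n + dedekind q p - 1 / (2 * p%:Q).
Proof. by case: p hp hpq => // p hp hpq; apply: lens_dE. Qed.
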